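(* Let $u$ be a field ordinal and let $n \geq 1$ be an integer. Then the $n$-closure of $u$ in $\mathrm{On}_2$ (which is an $n$-closure of $u$) is an ordinal.
   Context: $\oplus$ and $\otimes$ denote Nim-sum and Nim-product of ordinals, defined recursively by $\alpha \oplus \beta = \operatorname{mex}\{\alpha' \oplus \beta, \alpha \oplus \beta' \mid \alpha'<\alpha, \beta'<\beta\}$ and $\alpha \otimes \beta = \operatorname{mex}\{(\alpha' \otimes \beta) \oplus (\alpha \otimes \beta') \oplus (\alpha' \otimes \beta') \mid \alpha'<\alpha, \beta'<\beta\}$, where $\operatorname{mex}(S)$ is the least ordinal not in $S$. With these operations the class of ordinals is a Field of characteristic 2, denoted $\mathrm{On}_2$. An ordinal $u$ is identified with the set of smaller ordinals; a field ordinal is an ordinal $u$ that is a subfield of $\mathrm{On}_2$. For an integer $n \geq 1$, a field $F$ is $n$-closed if every non-constant polynomial in $F[X]$ of degree at most $n$ has at least one root in $F$. For a field $K$ with algebraic closure $\overline{K}$, the $n$-closure of $K$ is $\overline{K}^n = \bigcap F$, the intersection over all $n$-closed fields $F$ with $K \subset F \subset \overline{K}$. The $n$-closure of $u$ in $\mathrm{On}_2$ is obtained by taking $\overline{u}$ to be the algebraic closure of $u$ in $\mathrm{On}_2$ (the set of all ordinals algebraic over $u$). *)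

(* Defs.v *)
From HB Require Import structures.
From mathcomp Require Import all_boot all_order all_algebra ssrAC.
From mathcomp Require Import boolp classical_sets.

Set Implicit Arguments.
Unset Strict Implicit.
Unset Printing Implicit Defensive.

Import Order.TTheory GRing.Theory.

Local Open Scope classical_set_scope.
Local Open Scope quotient_scope.

(* [sup f] denotes the least ordinal greater than all the [f a]: every ordinal
   is the strict supremum of a family, indexed by a type of the universe at
   hand, of ordinals. Distinct trees may denote the same ordinal. *)
Inductive tree : Type := sup (A : Type) of (A -> tree).

(* [sup f <= sup g] iff every [f a] is less than [sup g], i.e. at most
   some [g b]. *)
Fixpoint tree_le (s t : tree) : Prop :=
  match s, t with
  | sup A f, sup B g => forall a, exists b, tree_le (f a) (g b)
  end.

Definition tree_lt (s t : tree) : Prop :=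
  match t with sup B g => exists b, tree_le s (g b) end.

Lemma tree_le_refl t : tree_le t t.
Proof. by elim: t => A f IH a; exists a; exact: IH. Qed.

Lemma tree_le_trans s t u : tree_le s t -> tree_le t u -> tree_le s u.
Proof.
elim: s t u => A f IH [B g] [C h] /= fg gh a.
have [b fab] := fg a; have [c gbc] := gh b.
by exists c; exact: IH fab gbc.
Qed.

Lemma tree_le_sup A (f : A -> tree) a : tree_le (f a) (sup f).
Proof.
have [t ft] : exists t, t = f a by exists (f a).
elim: t A f a ft => B g IH A f a fa; rewrite -fa => b; exists a.
by rewrite -fa; exact: IH.
Qed.

Lemma tree_lt_le s t : tree_lt s t -> tree_le s t.
Proof. by case: t => A f [a /tree_le_trans]; apply; exact: tree_le_sup. Qed.

Lemma tree_le_or_lt s t : tree_le s t \/ tree_lt t s.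
Proof.
elim: s t => A f IH [B g].
have [|/existsNP[a Na]] := pselect (forall a, exists b, tree_le (f a) (g b)).
  by left.
right; exists a; case E: (f a) Na (IH a) => [C h] Na {}IH b.
by case: (IH (g b)) => // le_fg; case: Na; exists b.
Qed.

Lemma tree_lt_irr s t : tree_lt s t -> ~ tree_le t s.
Proof.
suff irr A (f : A -> tree) a : ~ tree_le (sup f) (f a).
  case: t => A f [a sfa] fs; apply: (@irr A f a).
  exact: tree_le_trans fs sfa.
have [r fr] : exists r, r = f a by exists (f a).
elim: r A f a fr => B g IH A f a fa; rewrite -fa => /= /(_ a)[b].
by rewrite -fa; exact: IH.
Qed.

Lemma tree_lt_wf : well_founded tree_lt.
Proof.
suff acc : forall t s, tree_le s t -> Acc tree_lt s.
  by move=> r; apply: (acc r); exact: tree_le_refl.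
elim=> A f IH [B g] gf; constructor=> t [b tgb].
by have [a gfb] := gf b; apply: (IH a); exact: tree_le_trans tgb gfb.
Qed.

Definition tree_equiv (s t : tree) : bool :=
  `[< tree_le s t /\ tree_le t s >].

Lemma tree_equiv_is_equiv : equiv_class_of tree_equiv.
Proof.
split=> [t|s t|s t u].
- by apply/asboolP; split; exact: tree_le_refl.
- by apply/asboolP/asboolP => -[].
- move=> /asboolP[st ts] /asboolP[tu ut]; apply/asboolP.
  by split; [exact: tree_le_trans tu|exact: tree_le_trans ts].
Qed.

HB.instance Definition _ := gen_eqMixin tree.
HB.instance Definition _ := gen_choiceMixin tree.

Canonical tree_equiv_rel := EquivRelPack tree_equiv_is_equiv.

(* The ordinals whose underlying set is small (indexed by a type of the universe
   at hand), with Leibniz equality: a proper class relative to that universe. *)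
Definition On : Type := {eq_quot tree_equiv_rel}.

HB.instance Definition _ := Choice.on On.
HB.instance Definition _ := Quotient.on On.

Definition on_le (x y : On) : bool := `[< tree_le (repr x) (repr y) >].

Lemma on_eqP s t : \pi_On s = \pi_On t <-> tree_le s t /\ tree_le t s.
Proof.
have e := @eqmodP _ tree_equiv_rel s t.
by split=> [/e/asboolP|st]; last by apply/e/asboolP.
Qed.

Lemma on_lePi s t : on_le (\pi_On s) (\pi_On t) <-> tree_le s t.
Proof.
have reprK r : tree_le (repr (\pi_On r)) r /\ tree_le r (repr (\pi_On r)).
  by apply/on_eqP; rewrite reprK.
have [[s1 s2] [t1 t2]] := (reprK s, reprK t).
split=> [/asboolP st|st]; last apply/asboolP.
  exact: tree_le_trans (tree_le_trans s2 st) t1.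
exact: tree_le_trans (tree_le_trans s1 st) t2.
Qed.

Lemma on_le_refl : reflexive on_le.
Proof. by move=> x; apply/asboolP; exact: tree_le_refl. Qed.

Lemma on_le_anti : antisymmetric on_le.
Proof.
move=> x y /andP[/asboolP xy /asboolP yx].
by rewrite -[x]reprK -[y]reprK; apply/on_eqP.
Qed.

Lemma on_le_trans : transitive on_le.
Proof.
move=> y x z /asboolP xy /asboolP yz; apply/asboolP.
exact: tree_le_trans xy yz.
Qed.

Lemma on_le_total : total on_le.
Proof.
move=> x y; apply/orP; case: (tree_le_or_lt (repr x) (repr y)) => xy.
  by left; apply/asboolP.
by right; apply/asboolP; exact: tree_lt_le.
Qed.

Fact on_display : Order.disp_t. Proof. exact: Order.Disp tt tt. Qed.

HB.instance Definition _ :=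
  Order.Le_isPOrder.Build on_display On on_le_refl on_le_anti on_le_trans.
HB.instance Definition _ :=
  Order.POrder_isTotal.Build on_display On on_le_total.

Lemma on_ltPi s t : (\pi_On s < \pi_On t)%O <-> tree_lt s t.
Proof.
rewrite ltNge; split.
  by case: (tree_le_or_lt t s) => // /on_lePi ts /negP[].
by move=> /tree_lt_irr st; apply/negP => /on_lePi.
Qed.

Lemma on_lt_wf : well_founded (fun x y : On => (x < y)%O).
Proof.
move=> x; rewrite -[x]reprK; elim/(well_founded_ind tree_lt_wf): (repr x).
move=> {x} t IH; constructor=> y; rewrite -[y]reprK => /on_ltPi.
exact: IH.
Qed.

Lemma on_ind (P : On -> Prop) :
  (forall x, (forall y, (y < x)%O -> P y) -> P x) -> forall x, P x.
Proof. exact: (well_founded_ind on_lt_wf). Qed.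

(* Replacement: families of ordinals indexed by a type of the universe at hand
   are bounded. *)
Lemma on_bounded (A : Type) (f : A -> On) : exists m, forall a, (f a < m)%O.
Proof.
exists (\pi_On (sup (fun a => repr (f a)))) => a.
by rewrite -[f a]reprK; apply/on_ltPi; exists a; exact: tree_le_refl.
Qed.

(* Indexes the ordinals below [t]. *)
Fixpoint below (t : tree) : Type :=
  match t with sup A f => {a : A & option (below (f a))} end.

Fixpoint below_val (t : tree) : below t -> tree :=
  match t with
  | sup A f => fun p => match projT2 p with
                        | Some q => below_val q
                        | None => f (projT1 p)
                        end
  end.

Lemma below_valP t s : tree_lt s t -> exists p : below t, tree_equiv s (below_val p).
Proof.
elim: t s => A f IH s [a sfa].
have [fas|/IH[p sp]] := tree_le_or_lt (f a) s.
  by exists (existT _ a None); apply/asboolP.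
by exists (existT _ a (Some p)).
Qed.

(* The set of smaller ordinals, with which the ordinal [u] is identified. *)
Definition seg (u : On) : set On := [set x | (x < u)%O].

Lemma seg_small (u : On) :
  exists (A : Type) (f : A -> On), forall x, seg u x -> exists a, f a = x.
Proof.
exists (below (repr u)), (fun p => \pi_On (below_val p)) => x xu.
have /below_valP[p xp] : tree_lt (repr x) (repr u).
  by apply/on_ltPi; rewrite !reprK.
by exists p; rewrite -[x]reprK; apply/esym/on_eqP/asboolP.
Qed.

Lemma seg_image2_bounded (u v : On) (F : On -> On -> On) :
  exists m, forall x y, seg u x -> seg v y -> (F x y < m)%O.
Proof.
have [[A [f fP]] [B [g gP]]] := (seg_small u, seg_small v).
have [m mP] := on_bounded (fun p : A * B => F (f p.1) (g p.2)).
exists m => x y /fP[a <-] /gP[b <-]; exact: (mP (a, b)).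
Qed.

Definition on_zero : On := \pi_On (sup (of_void tree)).

(* The default value of [xget] is used only if [S] contains all ordinals. *)
Definition mex (S : set On) : On :=
  xget on_zero [set m | ~ S m /\ forall k, (k < m)%O -> S k].

Lemma mexP (S : set On) (m : On) : (forall x, S x -> (x < m)%O) ->
  ~ S (mex S) /\ forall k, (k < mex S)%O -> S k.
Proof.
move=> Sm; apply: (@xgetPex _ on_zero
  [set m | ~ S m /\ forall k, (k < m)%O -> S k]).
have: ~ S m by move/Sm; rewrite ltxx.
elim/on_ind: m {Sm} => m IH Nm.
have [[k [km Nk]]|Sm] := pselect (exists k, (k < m)%O /\ ~ S k); first exact: IH Nk.
exists m; split=> // k km; apply: contrapT => Nk; apply: Sm.
by exists k.
Qed.

Lemma on_le0 (x : On) : (on_zero <= x)%O.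
Proof. by rewrite -[x]reprK; apply/on_lePi; case: (repr x) => A f []. Qed.

Lemma mex_set0 : mex set0 = on_zero.
Proof.
have [_ m0] : ~ set0 (mex set0) /\ forall k, (k < mex set0)%O -> set0 k.
  exact: (@mexP set0 on_zero).
by apply/eqP; rewrite eq_le on_le0 andbT leNgt; apply/negP => /m0.
Qed.

(* [nim_sumE] and [nim_prodE] below are the usual recursive equations. *)
Definition nim_sum : On -> On -> On :=
  Fix on_lt_wf (fun=> On -> On) (fun a sum_a =>
    Fix on_lt_wf (fun=> On) (fun b sum_ab =>
      mex [set c | (exists a' (lt_a : (a' < a)%O), c = sum_a a' lt_a b) \/
                   (exists b' (lt_b : (b' < b)%O), c = sum_ab b' lt_b)])).

Definition nim_prod : On -> On -> On :=
  Fix on_lt_wf (fun=> On -> On) (fun a prod_a =>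
    Fix on_lt_wf (fun=> On) (fun b prod_ab =>
      mex [set c | exists a' (lt_a : (a' < a)%O) b' (lt_b : (b' < b)%O),
        c = nim_sum (nim_sum (prod_a a' lt_a b) (prod_ab b' lt_b))
                    (prod_a a' lt_a b')])).

Lemma on_FixE (T : Type) (F : forall x : On, (forall y, (y < x)%O -> T) -> T) x :
  Fix on_lt_wf (fun=> T) F x = F x (fun y _ => Fix on_lt_wf (fun=> T) F y).
Proof.
apply: (Fix_eq on_lt_wf (fun=> T)) => {}x f g fg; congr (F x).
by apply: functional_extensionality_dep => y; apply: funext => yx; exact: fg.
Qed.

Lemma nim_sumE a b : nim_sum a b =
  mex ([set nim_sum a' b | a' in seg a] `|` [set nim_sum a b' | b' in seg b]).
Proof.
rewrite {1}/nim_sum on_FixE on_FixE; congr mex; apply/seteqP; split=> c /=.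
  case=> [[a' [a'a ->]]|[b' [b'b ->]]]; first by left; exists a'.
  by right; exists b' => //; rewrite {1}/nim_sum on_FixE.
case=> [[a' a'a <-]|[b' b'b <-]]; first by left; exists a', a'a.
by right; exists b', b'b; rewrite {1}/nim_sum on_FixE.
Qed.

Lemma nim_prodE a b : nim_prod a b =
  mex [set c | exists a' b', [/\ (a' < a)%O, (b' < b)%O &
    c = nim_sum (nim_sum (nim_prod a' b) (nim_prod a b')) (nim_prod a' b')]].
Proof.
have E b' : Fix on_lt_wf (fun=> On) (fun b prod_ab =>
      mex [set c | exists a' (lt_a : (a' < a)%O) b' (lt_b : (b' < b)%O),
        c = nim_sum (nim_sum (nim_prod a' b) (prod_ab b' lt_b))
                    (nim_prod a' b')]) b' = nim_prod a b'.
  by rewrite [RHS]/nim_prod [in RHS]on_FixE.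
rewrite -E on_FixE; congr mex; apply/seteqP; split=> c /=.
  by move=> [a' [a'a [b' [b'b ->]]]]; exists a', b'; split=> //; rewrite E.
by move=> [a' [b' [a'a b'b ->]]]; exists a', a'a, b', b'b; rewrite E.
Qed.

Lemma nim_sum_spec a b :
  [/\ forall a', (a' < a)%O -> nim_sum a' b <> nim_sum a b,
      forall b', (b' < b)%O -> nim_sum a b' <> nim_sum a b &
      forall c, (c < nim_sum a b)%O ->
        (exists2 a', (a' < a)%O & c = nim_sum a' b) \/
        (exists2 b', (b' < b)%O & c = nim_sum a b')].
Proof.
have [m1 m1P] := seg_image2_bounded a a (fun x _ => nim_sum x b).
have [m2 m2P] := seg_image2_bounded b b (fun x _ => nim_sum a x).
rewrite [nim_sum a b]nim_sumE.
set S := _ `|` _; have [|NS ltS] := @mexP S (Order.max m1 m2).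
  move=> x [[y ya <-]|[y yb <-]]; rewrite lt_max.
    by rewrite (m1P y y ya ya).
  by rewrite (m2P y y yb yb) orbT.
split=> [a' a'a E|b' b'b E|c /ltS[[a' a'a <-]|[b' b'b <-]]].
- by apply: NS; left; exists a'.
- by apply: NS; right; exists b'.
- by left; exists a'.
- by right; exists b'.
Qed.

Lemma nim_prod_spec a b :
  (forall a' b', (a' < a)%O -> (b' < b)%O -> nim_prod a b <>
     nim_sum (nim_sum (nim_prod a' b) (nim_prod a b')) (nim_prod a' b')) /\
  (forall c, (c < nim_prod a b)%O -> exists a' b', [/\ (a' < a)%O, (b' < b)%O &
     c = nim_sum (nim_sum (nim_prod a' b) (nim_prod a b')) (nim_prod a' b')]).
Proof.
have [m mP] := seg_image2_bounded a b (fun a' b' =>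
  nim_sum (nim_sum (nim_prod a' b) (nim_prod a b')) (nim_prod a' b')).
rewrite [nim_prod a b]nim_prodE.
set S := [set c | _]; have [|NS ltS] := @mexP S m.
  by move=> x [a' [b' [a'a b'b ->]]]; exact: mP.
by split=> // a' b' a'a b'b E; apply: NS; exists a', b'; split=> //; rewrite -E.
Qed.

Lemma nim_sumC : commutative nim_sum.
Proof.
elim/on_ind=> a IHa; elim/on_ind=> b IHb.
rewrite (nim_sumE a b) (nim_sumE b a) setUC; congr (mex (_ `|` _)).
  by apply: eq_imagel => x xb; exact: IHb.
by apply: eq_imagel => x xa; exact: IHa.
Qed.

Lemma nim_sumI a : injective (nim_sum a).
Proof.
move=> b b' E; case: (ltgtP b b') => // lt_b.
  by have [_ /(_ _ lt_b)] := nim_sum_spec a b'.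
by have [_ /(_ _ lt_b)] := nim_sum_spec a b; rewrite E.
Qed.

Lemma nim_sumA : associative nim_sum.
Proof.
elim/on_ind=> a IHa; elim/on_ind=> b IHb; elim/on_ind=> c IHc.
case: (ltgtP (nim_sum a (nim_sum b c)) (nim_sum (nim_sum a b) c)) => // lt_E.
  have [_ _ /(_ _ lt_E)[[d dab E]|[c' c'c E]]] := nim_sum_spec (nim_sum a b) c.
    have [_ _ /(_ _ dab)[[a' a'a Ed]|[b' b'b Ed]]] := nim_sum_spec a b.
      move: E; rewrite Ed -IHa // nim_sumC [RHS]nim_sumC => /nim_sumI aa'.
      by rewrite aa' ltxx in a'a.
    move: E; rewrite Ed -IHb // => /nim_sumI.
    rewrite nim_sumC [RHS]nim_sumC => /nim_sumI bb'.
    by rewrite bb' ltxx in b'b.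
  by move: E; rewrite -IHc // => /nim_sumI/nim_sumI cc'; rewrite cc' ltxx in c'c.
have [_ _ /(_ _ lt_E)[[a' a'a E]|[d dbc E]]] := nim_sum_spec a (nim_sum b c).
  move: E; rewrite IHa // nim_sumC [RHS]nim_sumC => /nim_sumI.
  rewrite nim_sumC [RHS]nim_sumC => /nim_sumI aa'.
  by rewrite aa' ltxx in a'a.
have [_ _ /(_ _ dbc)[[b' b'b Ed]|[c' c'c Ed]]] := nim_sum_spec b c.
  move: E; rewrite Ed IHb // nim_sumC [RHS]nim_sumC => /nim_sumI/nim_sumI bb'.
  by rewrite bb' ltxx in b'b.
by move: E; rewrite Ed IHc // => /nim_sumI cc'; rewrite cc' ltxx in c'c.
Qed.

Lemma on_lt0 (x : On) : (x < on_zero)%O = false.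
Proof. by apply: le_gtF; exact: on_le0. Qed.

Lemma nim_sum0 : left_id on_zero nim_sum.
Proof.
elim/on_ind=> a IH; have [_ _ lt_a] := nim_sum_spec on_zero a.
case: (ltgtP (nim_sum on_zero a) a) => // lt_E.
  by have /nim_sumI E := IH _ lt_E; rewrite E ltxx in lt_E.
have [[z]|[a' a'a E]] := lt_a _ lt_E; first by rewrite on_lt0.
by rewrite IH // in E; rewrite E ltxx in a'a.
Qed.

Lemma nim_sumK a : nim_sum a a = on_zero.
Proof.
elim/on_ind: a => a IH; apply/eqP; rewrite eq_le on_le0 andbT leNgt.
have [_ _ lt_aa] := nim_sum_spec a a.
have ne a' : (a' < a)%O -> nim_sum a a' <> on_zero.
  move=> a'a; rewrite -(IH _ a'a) nim_sumC => /nim_sumI E.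
  by rewrite E ltxx in a'a.
apply/negP => /lt_aa[] [a' /ne a'a E]; last by rewrite E in a'a.
by apply: a'a; rewrite nim_sumC.
Qed.

HB.instance Definition _ :=
  GRing.isZmodule.Build On nim_sumA nim_sumC nim_sum0 nim_sumK.

Local Open Scope ring_scope.

Local Notation "a ⊗ b" := (nim_prod a b) (at level 40, left associativity).

Lemma on_addii (a : On) : a + a = 0. Proof. exact: nim_sumK. Qed.

Lemma on_oppE (a : On) : - a = a. Proof. by []. Qed.

Lemma on_addK (a b : On) : a + b + b = a.
Proof. by rewrite -addrA on_addii addr0. Qed.

Lemma on_gt0 (a : On) : ((0 : On) < a)%O = (a != 0).
Proof. by rewrite lt_neqAle on_le0 andbT eq_sym. Qed.

Lemma nim_prod_lt (a b c : On) : (c < a ⊗ b)%O ->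
  exists a' b', [/\ (a' < a)%O, (b' < b)%O & c = a' ⊗ b + a ⊗ b' + a' ⊗ b'].
Proof. by have [_] := nim_prod_spec a b; exact. Qed.

(* Symmetric form of the exclusions in the definition of [a ⊗ b]. *)
Lemma nim_prod_ne (a a' b b' : On) : a != a' -> b != b' ->
  a ⊗ b <> a' ⊗ b + a ⊗ b' + a' ⊗ b'.
Proof.
have ne x x' y y' : (x' < x)%O -> (y' < y)%O ->
    x ⊗ y <> x' ⊗ y + x ⊗ y' + x' ⊗ y'.
  by have [H _] := nim_prod_spec x y; exact: H.
case: (ltgtP a a') => // lt_a _; case: (ltgtP b b') => // lt_b _ E.
- by apply: (ne _ _ _ _ lt_a lt_b); rewrite E !addrA !(on_addK, on_addii) add0r.
- by apply: (ne _ _ _ _ lt_a lt_b); rewrite E !on_addK.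
- apply: (ne _ _ _ _ lt_a lt_b).
  by rewrite E [_ + (_ + _)]addrC on_addK addrAC on_addii add0r.
- exact: (ne _ _ _ _ lt_a lt_b).
Qed.

Lemma nim_prodC (a b : On) : a ⊗ b = b ⊗ a.
Proof.
elim/on_ind: a b => a IHa; elim/on_ind=> b IHb.
have lt_ne c d : (forall x, (x < c)%O -> forall y, x ⊗ y = y ⊗ x) ->
    (forall x, (x < d)%O -> c ⊗ x = x ⊗ c) -> ~ (c ⊗ d < d ⊗ c)%O.
  move=> IHc IHd /nim_prod_lt[d' [c' [d'd c'c]]].
  rewrite -IHd // -(IHc _ c'c) -(IHc _ c'c) [c ⊗ d' + _]addrC.
  by apply: nim_prod_ne; rewrite gt_eqF.
case: (ltgtP (a ⊗ b) (b ⊗ a)) => // lt_ab; first by case: (lt_ne a b IHa IHb).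
move: lt_ab => /nim_prod_lt[a' [b' [a'a b'b]]].
rewrite (IHa _ a'a b) (IHb _ b'b) (IHa _ a'a b') [b ⊗ a' + _]addrC.
by move=> E; case: (@nim_prod_ne b b' a a'); rewrite ?gt_eqF.
Qed.

Lemma nim_prod0 (a : On) : 0 ⊗ a = 0.
Proof.
apply/eqP; rewrite eq_le on_le0 andbT leNgt; apply/negP.
by move=> /nim_prod_lt[a' [b' []]]; rewrite on_lt0.
Qed.

Definition on_one : On := mex [set on_zero].

Lemma on_one_neq0 : on_one != 0.
Proof.
have [m mP] := on_bounded (fun _ : unit => on_zero).
have [N0 _] : ~ [set on_zero] on_one /\ forall k, (k < on_one)%O -> [set on_zero] k.
  by apply: (@mexP _ m) => _ ->; exact: mP tt.
by apply/eqP.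
Qed.

Lemma on_lt1 (x : On) : (x < on_one)%O = (x == 0).
Proof.
have [m mP] := on_bounded (fun _ : unit => on_zero).
have [_ lt1] : ~ [set on_zero] on_one /\ forall k, (k < on_one)%O -> [set on_zero] k.
  by apply: (@mexP _ m) => _ ->; exact: mP tt.
apply/idP/eqP => [/lt1 //|->]; by rewrite on_gt0 on_one_neq0.
Qed.

Lemma nim_prod1 (a : On) : on_one ⊗ a = a.
Proof.
elim/on_ind: a => a IH; case: (ltgtP (on_one ⊗ a) a) => // lt_E.
  have E := IH _ lt_E; case: (@nim_prod_ne on_one 0 a (on_one ⊗ a)).
  - exact: on_one_neq0.
  - by rewrite gt_eqF.
  - by rewrite !nim_prod0 E add0r addr0.
move: lt_E => /nim_prod_lt[x [b]]; rewrite on_lt1 => -[/eqP-> ba].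
by rewrite !nim_prod0 add0r addr0 IH // => E; rewrite E ltxx in ba.
Qed.

Lemma nim_prodDr (a b c : On) : a ⊗ (b + c) = a ⊗ b + a ⊗ c.
Proof.
elim/on_ind: a b c => a IHa; elim/on_ind=> b IHb; elim/on_ind=> c IHc.
have addKC (p q r s t : On) : p + q + (r + s) + (t + q) = p + r + t + s.
  by rewrite [p + q + _]addrACA [t + q]addrC -!addrA [s + _]addrCA [q + _]addrA
    on_addii add0r [s + t]addrC.
have expand a' y y' z : (a' < a)%O -> a ⊗ (y' + z) = a ⊗ y' + a ⊗ z ->
    a' ⊗ (y + z) + a ⊗ (y' + z) + a' ⊗ (y' + z) =
    a' ⊗ y + a ⊗ y' + a' ⊗ y' + a ⊗ z.
  by move=> a'a ->; rewrite !(IHa _ a'a) addKC.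
have IHc' c' : (c' < c)%O -> a ⊗ (c' + b) = a ⊗ c' + a ⊗ b.
  by move=> c'c; rewrite addrC IHc // addrC.
case: (ltgtP (a ⊗ (b + c)) (a ⊗ b + a ⊗ c)) => // lt_E.
  have [_ _ /(_ _ lt_E)[]] := nim_sum_spec (a ⊗ b) (a ⊗ c).
    move=> [z /nim_prod_lt[a' [b' [a'a b'b ->]]]].
    rewrite -[nim_sum _ _]/(_ + _) -(expand _ _ _ _ a'a (IHb _ b'b _)) => E.
    case: (@nim_prod_ne a a' (b + c) (b' + c)) => //; first by rewrite gt_eqF.
    by rewrite (inj_eq (addIr c)) gt_eqF.
  move=> [z /nim_prod_lt[a' [c' [a'a c'c ->]]]].
  rewrite -[nim_sum _ _]/(_ + _) [b + c]addrC [RHS]addrC.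
  rewrite -(expand _ _ _ _ a'a (IHc' _ c'c)) => E.
  case: (@nim_prod_ne a a' (c + b) (c' + b)) => //; first by rewrite gt_eqF.
  by rewrite (inj_eq (addIr b)) gt_eqF.
move/nim_prod_lt: lt_E => [a' [d [a'a]]].
have [_ _ /[apply]] := nim_sum_spec b c.
case=> [[b' b'b ->]|[c' c'c ->]]; rewrite -[nim_sum _ _]/(_ + _).
  rewrite (expand _ _ _ _ a'a (IHb _ b'b _)) => /addIr E.
  by case: (@nim_prod_ne a a' b b'); rewrite // gt_eqF.
rewrite addrC [b + c]addrC [b + c']addrC.
rewrite (expand _ _ _ _ a'a (IHc' _ c'c)) => /addIr E.
by case: (@nim_prod_ne a a' c c'); rewrite // gt_eqF.
Qed.

Lemma nim_prodDl (a b c : On) : (a + b) ⊗ c = a ⊗ c + b ⊗ c.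
Proof. by rewrite nim_prodC nim_prodDr nim_prodC [c ⊗ b]nim_prodC. Qed.

Lemma nim_prodA (a b c : On) : a ⊗ (b ⊗ c) = a ⊗ b ⊗ c.
Proof.
have lt_ne x y z :
    (forall x' y' z', (x' <= x)%O -> (y' <= y)%O -> (z' <= z)%O ->
       [|| x' < x, y' < y | z' < z]%O -> x' ⊗ (y' ⊗ z') = x' ⊗ y' ⊗ z') ->
    ~ (x ⊗ y ⊗ z < x ⊗ (y ⊗ z))%O.
  move=> IH /nim_prod_lt[x' [e [x'x /nim_prod_lt[y' [z' [y'y z'z ->]]]]]].
  rewrite !nim_prodDr !IH ?(ltW x'x, ltW y'y, ltW z'z, x'x, y'y, z'z, orbT) //.
  set d := x' ⊗ y + x ⊗ y' + x' ⊗ y' => E.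
  case: (@nim_prod_ne (x ⊗ y) d z z'); last 1 first.
  - rewrite E !nim_prodDl !addrA.
    by rewrite (ACl (1*2*5*3*6*4*7)).
  - by apply/eqP; apply: nim_prod_ne; rewrite gt_eqF.
  - by rewrite gt_eqF.
elim/on_ind: a b c => a IHa; elim/on_ind=> b IHb; elim/on_ind=> c IHc.
have IH x y z : (x <= a)%O -> (y <= b)%O -> (z <= c)%O ->
    [|| x < a, y < b | z < c]%O -> x ⊗ (y ⊗ z) = x ⊗ y ⊗ z.
  rewrite le_eqVlt => /predU1P[->|/IHa //]; rewrite ltxx /=.
  rewrite le_eqVlt => /predU1P[->|/IHb //]; rewrite ltxx /=.
  by move=> _ /IHc.
case: (ltgtP (a ⊗ (b ⊗ c)) (a ⊗ b ⊗ c)) => // [|/(lt_ne _ _ _ IH) //].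
rewrite nim_prodC [b ⊗ c]nim_prodC [X in (_ < X)%O]nim_prodC [a ⊗ b]nim_prodC.
case/lt_ne => x y z xc yb za lt_xyz.
rewrite nim_prodC [y ⊗ z]nim_prodC [RHS]nim_prodC [x ⊗ y]nim_prodC IH //.
by case/or3P: lt_xyz => ->; rewrite ?orbT.
Qed.

HB.instance Definition _ := GRing.Zmodule_isComNzRing.Build On
  nim_prodA nim_prodC nim_prod1 nim_prodDl on_one_neq0.

Lemma on_mul_eq0 (a b : On) : a * b = 0 -> a = 0 \/ b = 0.
Proof.
have [->|a0] := eqVneq a 0; first by left.
have [->|b0] := eqVneq b 0; first by right.
move=> E; case: (@nim_prod_ne a 0 b 0) => //; rewrite -![_ ⊗ _]/(_ * _).
by rewrite E !mul0r mulr0 !addr0.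
Qed.

Lemma on_mulI (a b c : On) : a != 0 -> a * b = a * c -> b = c.
Proof.
move=> a0 /eqP; rewrite -subr_eq0 -mulrBr => /eqP/on_mul_eq0[/eqP|/eqP].
  by rewrite (negPf a0).
by rewrite subr_eq0 => /eqP.
Qed.

Lemma on_inv_ex (a : On) : a != 0 -> exists b, a * b = 1.
Proof.
elim/on_ind: a => a IH a0.
have [iv ivP] : exists iv : On -> On,
    forall x, (x < a)%O -> x != 0 -> x * iv x = 1.
  exists (fun x => xget 0 [set y | x * y = 1]) => x xa x0.
  exact: (@xgetPex _ 0 [set y | x * y = 1] (IH x xa x0)).
pose step x b := (1 + (x + a) * b) * iv x.
have stepE x b : (x < a)%O -> x != 0 -> x * step x b = 1 + (x + a) * b.
  by move=> xa x0; rewrite /step mulrCA ivP // mulr1.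
pose B := [set foldr step 0 s | s in
  [set s | all (fun x => (x < a)%O && (x != 0)) s]].
have B0 : B 0 by exists [::].
have BS x b : (x < a)%O -> x != 0 -> B b -> B (step x b).
  by move=> xa x0 [s sP <-]; exists (x :: s); rewrite //= xa x0.
have [m mP] : exists m, forall x, B x -> (x < m)%O.
  have [A [f fP]] := seg_small a.
  have [m mP] := on_bounded (fun s : seq A => foldr step 0 (map f s)).
  exists m => _ [s sP <-]; suff [t <-] : exists t, map f t = s by exact: mP.
  elim: s sP => [|x s IHs] /=; first by exists [::].
  by case/andP=> /andP[/fP[y <-] _] /IHs[t <-]; exists (y :: t).
have BN b : B b -> a * b <> 1.
  move=> [s sP <-]; elim: s sP => [|x s IHs] /=.
    by rewrite mulr0 => _ /esym/eqP; rewrite oner_eq0.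
  case/andP=> /andP[xa x0] /IHs; set c := foldr _ _ _ => Nc E.
  have : (x + a) * (1 + a * c) = 0.
    have -> : (x + a) * (1 + a * c) = x + a * (1 + (x + a) * c).
      by rewrite mulrDr mulr1 mulrCA -addrA -[X in x + (X + _)]mulr1 -mulrDr.
    by rewrite -stepE // mulrCA E mulr1 on_addii.
  case/on_mul_eq0 => /eqP; rewrite addr_eq0 on_oppE => /eqP E'.
    by rewrite E' ltxx in xa.
  by apply: Nc; rewrite E'.
have [NB ltB] := mexP mP; exists (mex B); set b := mex B in NB ltB *.
case: (ltgtP (a * b) 1) => // [|/nim_prod_lt[x [b' [xa /ltB Bb']]]].
  rewrite on_lt1 => /eqP/on_mul_eq0[/eqP|b0]; first by rewrite (negPf a0).
  by rewrite b0 in NB.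
rewrite -![_ ⊗ _]/(_ * _); have [->|x0] := eqVneq x 0.
  by rewrite !mul0r add0r addr0 => /esym/BN.
move=> E; case: NB; suff -> : b = step x b' by exact: BS.
apply: (on_mulI x0); rewrite stepE // E mulrDl.
by rewrite !addrA !on_addK.
Qed.

Definition on_inv (a : On) : On := xget 0 [set b | a * b = 1].

Lemma on_mulVf (a : On) : a != 0 -> on_inv a * a = 1.
Proof.
by move=> /on_inv_ex ex; rewrite mulrC; exact: (@xgetPex _ 0 [set b | a * b = 1]).
Qed.

Lemma on_inv0 : on_inv 0 = 0.
Proof.
rewrite /on_inv; case: xgetP => // x _ /=.
by rewrite mul0r => /esym/eqP; rewrite oner_eq0.
Qed.

(* The ring operations of [On] are from here on the Nim operations: this is
   the Field On_2. *)
HB.instance Definition _ := GRing.ComNzRing_isField.Build On on_mulVf on_inv0.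

Lemma on_addE (a b : On) : a + b = nim_sum a b. Proof. by []. Qed.

Lemma on_mulE (a b : On) : a * b = nim_prod a b. Proof. by []. Qed.

Lemma on_pchar2 : 2%N \in [pchar On].
Proof. by apply/andP; split=> //; rewrite mulr2n on_addii. Qed.

(* Fields are given as subsets of an ambient field [L]. *)
Definition subfield (L : fieldType) (F : set L) : Prop := divring_closed (mem F).

Definition n_closed (L : fieldType) (n : nat) (F : set L) : Prop :=
  forall p : {poly L}, p \is a polyOver (mem F) -> (1 < size p <= n.+1)%N ->
  exists2 x, F x & root p x.

Definition algebraic_over (L : fieldType) (K : set L) (x : L) : Prop :=
  exists p : {poly L}, [/\ p \is a polyOver (mem K), p != 0 & root p x].

Definition algebraically_closed (L : fieldType) (F : set L) : Prop :=
  forall p : {poly L}, p \is a polyOver (mem F) -> (1 < size p)%N ->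
  exists2 x, F x & root p x.

Definition is_algebraic_closure (L : fieldType) (K Kbar : set L) : Prop :=
  [/\ subfield Kbar, K `<=` Kbar, Kbar `<=` algebraic_over K &
      algebraically_closed Kbar].

(* The intersection of the n-closed fields between [K] and its algebraic
   closure [Kbar]. *)
Definition n_closure_in (L : fieldType) (n : nat) (K Kbar : set L) : set L :=
  \bigcap_(F in [set F | [/\ subfield F, n_closed n F, K `<=` F & F `<=` Kbar]]) F.

Definition is_n_closure (L : fieldType) (n : nat) (K C : set L) : Prop :=
  exists2 Kbar, is_algebraic_closure K Kbar & C = n_closure_in n K Kbar.

Definition field_ordinal (u : On) : Prop := subfield (seg u).

Definition on_algebraic_closure (u : On) : set On := algebraic_over (seg u).

Definition on_n_closure (n : nat) (u : On) : set On :=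
  n_closure_in n (seg u) (on_algebraic_closure u).

Definition is_ordinal (S : set On) : Prop := exists v : On, S = seg v.

(* Main.v *)
Require Import Defs.
From HB Require Import structures.
From mathcomp Require Import all_boot all_order all_algebra.
From mathcomp Require Import boolp classical_sets.

(* Any ordinal [w] outside a subfield [C] of On_2, all smaller ordinals being in
   [C], is a field ordinal: sums, products and inverses of elements of [w] are
   least excluded values of elements of [w], hence at most [w], and they lie in
   [C], hence differ from [w].
   If moreover [w] is a root of no nonzero polynomial over [w] of degree at most
   [n], then [w] is n-closed (a form of Conway's simplest extension theorem).
   Let [w] be the least ordinal outside the n-closure [C] of [u]. An n-closed
   field contains all the roots of the polynomials of degree at most [n] over
   it, so such a polynomial over [w] vanishing at [w] would put [w] in every
   n-closed field between [u] and its algebraic closure, hence in [C]. Thus [w]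
   is n-closed, and [C] is contained in [w] by minimality. The same argument,
   in all degrees, shows that the algebraic closure of [u] in On_2 is an
   algebraically closed ordinal. *)

Set Implicit Arguments.
Unset Strict Implicit.
Unset Printing Implicit Defensive.

Import Order.TTheory GRing.Theory.

Local Open Scope classical_set_scope.
Local Open Scope ring_scope.

(** * Subfields and the elements algebraic over them *)

(* Carries the proof [FP], from which the closure properties are inferred. *)
Definition subfield_pred (L : fieldType) (F : set L) of subfield F : {pred L} :=
  mem F.

HB.instance Definition _ (L : fieldType) (F : set L) (FP : subfield F) :=
  GRing.isDivringClosed.Build L (subfield_pred FP) FP.

Record subfield_type (L : fieldType) (F : set L) (FP : subfield F) :=
  SubfieldType { subfield_val : L; _ : subfield_val \in subfield_pred FP }.

HB.instance Definition _ (L : fieldType) (F : set L) (FP : subfield F) :=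
  [isSub for @subfield_val L F FP].
HB.instance Definition _ (L : fieldType) (F : set L) (FP : subfield F) :=
  [Choice of subfield_type FP by <:].
HB.instance Definition _ (L : fieldType) (F : set L) (FP : subfield F) :=
  [SubChoice_isSubIntegralDomain of subfield_type FP by <:].
HB.instance Definition _ (L : fieldType) (F : set L) (FP : subfield F) :=
  [SubIntegralDomain_isSubField of subfield_type FP by <:].

Lemma subfield_polyOver (L : fieldType) (F : set L) (FP : subfield F)
    (p : {poly L}) :
  (p \is a polyOver (subfield_pred FP)) = (p \is a polyOver (mem F)).
Proof. by []. Qed.

Section Algebraic.
Variables (L : fieldType) (F : set L) (FP : subfield F).

Let iota : subfield_type FP -> L := val.

(** Over a field, algebraic and integral elements agree; closure under the field operations and
    transitivity are then inherited from integrality. *)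
Lemma algebraic_overP x : algebraic_over F x <-> integralOver iota x.
Proof.
split=> [[p []]|[q mq qx]].
  rewrite -subfield_polyOver => /polyOverP pF p0 px.
  apply: (integral_root p0 px) => _ /(nthP 0)[i _ <-].
  by have := integral_id iota (SubfieldType (pF i)).
exists (map_poly iota q); split=> //; last by rewrite monic_neq0 ?monic_map.
rewrite -subfield_polyOver; apply/polyOverP => i.
by rewrite coef_map; exact: (valP q`_i).
Qed.

Lemma sub_algebraic_over : F `<=` algebraic_over F.
Proof.
move=> x Fx; apply/algebraic_overP.
have Fx' : x \in subfield_pred FP by exact: mem_set.
by have := integral_id iota (SubfieldType Fx').
Qed.

Lemma algebraic_over_subfield : subfield (algebraic_over F).
Proof.
have mapP x : x \in mem (algebraic_over F : set L) <-> integralOver iota x.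
  by rewrite -algebraic_overP; split=> [/set_mem|/mem_set].
split=> [|x y /mapP ix /mapP iy|x y /mapP ix /mapP iy]; apply/mapP.
- exact: integral1.
- exact: integral_sub.
- exact: integral_div.
Qed.

Lemma algebraic_over_trans (p : {poly L}) x :
  p \is a polyOver (mem (algebraic_over F : set L)) -> p != 0 -> root p x ->
  algebraic_over F x.
Proof.
rewrite -(subfield_polyOver algebraic_over_subfield) => /polyOverP pA p0 px.
apply/algebraic_overP; apply: (integral_root p0 px).
by move=> _ /(nthP 0)[i _ <-]; apply/algebraic_overP/set_mem; exact: pA.
Qed.

Lemma polyOver_subfieldP (p : {poly L}) :
  p \is a polyOver (mem F) <-> exists q, p = map_poly iota q.
Proof.
rewrite -subfield_polyOver; split=> [/polyOverP pF|[q ->]]; last first.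
  by apply/polyOverP => i; rewrite coef_map; exact: (valP q`_i).
exists (\poly_(i < size p) SubfieldType (pF i)); apply/polyP => i.
rewrite coef_map coef_poly; case: ifP => // /negbT; rewrite -leqNgt => pi.
by rewrite nth_default // rmorph0.
Qed.

(** Induction on the degree: n-closedness yields one root [a] in [F], and dividing by ['X - a%:P]
    leaves a cofactor over [F] of lower degree, which has every root other than [a]. *)
Lemma n_closed_root (n : nat) (p : {poly L}) x :
  n_closed n F -> p \is a polyOver (mem F) -> (size p <= n.+1)%N -> p != 0 ->
  root p x -> F x.
Proof.
move=> nF /polyOver_subfieldP[q ->]; rewrite size_map_poly map_poly_eq0.
have [k] := ubnP (size q); elim: k q => // k IH q ltk qn q0 qx.
have q1 : (1 < size q)%N.
  by rewrite -(size_map_poly iota) (root_size_gt1 _ qx) ?map_poly_eq0.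
have [a Fa qa] : exists2 a, F a & root (map_poly iota q) a.
  by apply: nF; [apply/polyOver_subfieldP; exists q | rewrite size_map_poly q1].
pose b := SubfieldType (mem_set Fa : a \in subfield_pred FP).
have /factor_theorem[r Dq] : root q b by rewrite -(fmorph_root iota).
have r0 : r != 0 by apply: contraNneq q0 => r0; rewrite Dq r0 mul0r.
have szq : size q = (size r).+1.
  by rewrite Dq size_Mmonic ?monicXsubC // size_XsubC addn2.
have Diq : map_poly iota q = map_poly iota r * ('X - a%:P).
  by rewrite Dq rmorphM; congr (_ * _); exact: map_polyXsubC.
move: qx; rewrite Diq rootM root_XsubC.
case/orP=> [rx|/eqP-> //].
by apply: (IH r) => //; [rewrite -ltnS -szq | rewrite ltnW // -szq].
Qed.

End Algebraic.

(** * Initial segments of On_2 and the field operations *)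

Lemma on_add_lt (a b c : On) : (c < a + b)%O ->
  (exists2 a', (a' < a)%O & c = a' + b) \/
  (exists2 b', (b' < b)%O & c = a + b').
Proof. by have [_ _] := nim_sum_spec a b; exact. Qed.

Lemma on_mul_lt (a b c : On) : (c < a * b)%O ->
  exists a' b', [/\ (a' < a)%O, (b' < b)%O & c = a' * b + a * b' + a' * b'].
Proof. exact: nim_prod_lt. Qed.

(** Whatever lies below a Nim-sum or a Nim-product is one of its options, so once [x != w] it is
    enough to bound the options of [x] by [w]. *)
Lemma on_lt_of_options (w x : On) :
  x != w -> (forall y, (y < x)%O -> (y < w)%O) -> (x < w)%O.
Proof. by move=> xw lt_x; case: ltgtP xw => // /lt_x; rewrite ltxx. Qed.

Section SegSubfield.
Variables (C : set On) (w : On).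
Hypotheses (CP : subfield C) (wC : seg w `<=` C) (Nw : ~ C w).

Let segC x : (x < w)%O -> x \in subfield_pred CP.
Proof. by move=> xw; apply: mem_set; exact: wC. Qed.

Let neqC x : x \in subfield_pred CP -> x != w.
Proof. by move=> /set_mem Cx; apply/eqP => xw; apply: Nw; rewrite -xw. Qed.

Lemma seg_add x y : (x < w)%O -> (y < w)%O -> (x + y < w)%O.
Proof.
elim/on_ind: x y => x IHx; elim/on_ind=> y IHy xw yw.
apply: on_lt_of_options => [|z /on_add_lt[[x' x'x ->]|[y' y'y ->]]].
- by apply: neqC; rewrite rpredD ?segC.
- by apply: IHx => //; exact: lt_trans x'x xw.
- by apply: IHy => //; exact: lt_trans y'y yw.
Qed.

Lemma seg_mul x y : (x < w)%O -> (y < w)%O -> (x * y < w)%O.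
Proof.
elim/on_ind: x y => x IHx; elim/on_ind=> y IHy xw yw.
apply: on_lt_of_options => [|z /on_mul_lt[x' [y' [x'x y'y ->]]]].
  by apply: neqC; rewrite rpredM ?segC.
have [x'w y'w] := (lt_trans x'x xw, lt_trans y'y yw).
by rewrite !seg_add ?(IHx x') ?IHy.
Qed.

Lemma seg1 : ((1 : On) < w)%O.
Proof.
apply: on_lt_of_options => [|y]; first by apply: neqC; rewrite rpred1.
rewrite on_lt1 => /eqP->; rewrite on_gt0 eq_sym; apply: neqC.
exact: rpred0.
Qed.

(* If [x^-1 > w] with [x] least, then no option of [x * w] equals 1, so that
   [x * w = 1] and [x^-1 = w]. *)
Lemma seg_inv x : (x < w)%O -> (x^-1 < w)%O.
Proof.
elim/on_ind: x => x IHx xw; have [->|x0] := eqVneq x 0.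
  by rewrite invr0 (le_lt_trans (on_le0 x) xw).
have /neqC : x^-1 \in subfield_pred CP by rewrite rpredV segC.
rewrite neq_lt => /orP[//|wx'].
suff xw1 : x * w = 1.
  by rewrite -(mulKf x0 w) xw1 mulr1 ltxx in wx'.
have w0 : w != 0 by rewrite -on_gt0 (le_lt_trans (on_le0 x) xw).
(* A nonzero [x * w] is 1 or exceeds 1; in the latter case 1 is one of its options. *)
have := mulf_neq0 x0 w0; rewrite -on_lt1.
case: ltgtP => // /on_mul_lt[x' [b [x'x bw E]]] _; move: E.
have x'w := lt_trans x'x xw.
have [->|x'0] := eqVneq x' 0.
  rewrite !mul0r add0r addr0 => xb; rewrite -(mulKf x0 b) -xb mulr1 in bw.
  by have := lt_trans wx' bw; rewrite ltxx.
move=> E'; have E : 1 = x' * w + x * b + x' * b by exact: E'.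
(* The left-hand side is the solution of [E] for [w], built from elements below [w]. *)
have : (x'^-1 * (1 + x * b) + b < w)%O.
  by rewrite seg_add ?seg_mul ?IHx ?seg_add ?seg_mul ?seg1.
suff -> : x'^-1 * (1 + x * b) + b = w by rewrite ltxx.
apply: (mulfI x'0); rewrite mulrDr mulVKf // {1}E.
by rewrite [X in X + _]addrAC !on_addK.
Qed.

Lemma seg_subfield : subfield (seg w).
Proof.
have segP x : x \in mem (seg w) <-> (x < w)%O by split=> [/set_mem|/mem_set].
split=> [|x y /segP xw /segP yw|x y /segP xw /segP yw]; apply/segP.
- exact: seg1.
- by rewrite on_oppE seg_add.
- by rewrite seg_mul ?seg_inv.
Qed.

End SegSubfield.

(** * Splitting of polynomials over a field ordinal *)

Lemma size_monicB (R : nzRingType) (p q : {poly R}) k :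
  p \is monic -> q \is monic -> size p = k.+1 -> size q = k.+1 ->
  (size (p - q)%R <= k)%N.
Proof.
move=> mp mq sp sq; apply/leq_sizeP => j; rewrite leq_eqVlt coefB.
case/predU1P=> [<-|kj]; last by rewrite !nth_default ?sp ?sq ?subrr.
have /monicP := mp; have /monicP := mq.
by rewrite !lead_coefE sp sq /= => -> ->; rewrite subrr.
Qed.

(** Write Q for [w ^+ k] and P for the product found at rank [k]. In characteristic 2 the option a Q
    + w (Q + P) + a (Q + P) of w Q simplifies to w Q + (w + a) P. *)
Lemma on_expn_lt (w z : On) k : (z < w ^+ k)%O ->
  exists s : seq On, [/\ all (fun a => (a < w)%O) s, size s = k &
    z = w ^+ k + \prod_(a <- s) (w + a)].
Proof.
elim: k z => [|k IH] z.
  rewrite expr0 on_lt1 => /eqP->; exists [::]; split=> //.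
  by rewrite big_nil on_addii.
rewrite exprS => /on_mul_lt[a [_ [aw /IH[s [sw sk ->]] ->]]].
exists (a :: s); split; rewrite /= ?aw ?sk // big_cons.
set P := \prod_(_ <- _) _; set Q := w ^+ k.
by rewrite !mulrDr addrAC [a * Q + _]addrA on_addii add0r mulrDl addrC addrA.
Qed.

Section SegSplit.
Variables (w : On) (wP : subfield (seg w)) (n : nat).

Hypothesis Nroot : forall p : {poly On}, p \is a polyOver (mem (seg w)) ->
  p != 0 -> (size p <= n.+1)%N -> ~~ root p w.

(** The linear span over [seg w] of the first [k] powers of [w], starting with 1. *)
Let S k (x : On) := exists2 p : {poly On},
  (p \is a polyOver (subfield_pred wP)) && (size p <= k)%N & x = p.[w].

Let segP x : (x \in subfield_pred wP) = (x < w)%O.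
Proof. by apply/idP/idP => [/set_mem|xw]; last exact: mem_set. Qed.

Let S_add k x y : S k x -> S k y -> S k (x + y).
Proof.
move=> [p /andP[pw pk] ->] [q /andP[qw qk] ->]; exists (p + q).
  by rewrite rpredD //= (leq_trans (size_polyD _ _)) // geq_max pk.
by rewrite hornerD.
Qed.

Let S_mul k a x : (a < w)%O -> S k x -> S k (a * x).
Proof.
move=> aw [p /andP[pw pk] ->]; exists (a *: p).
  by rewrite polyOverZ ?segP //= (leq_trans (size_scale_leq _ _)).
by rewrite hornerZ.
Qed.

Let S_leading k x :
  S k.+1 x <-> exists a y, [/\ (a < w)%O, S k y & x = a * w ^+ k + y].
Proof.
split=> [[p /andP[pw pk] ->]|[a [_ [aw [p /andP[pw pk] ->] ->]]]].
  exists p`_k, (take_poly k p).[w]; split.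
  - by rewrite -segP (polyOverP pw).
  - exists (take_poly k p) => //; rewrite size_take_poly andbT.
    apply/polyOverP => i; rewrite coef_take_poly.
    by case: ifP; rewrite ?(polyOverP pw) ?rpred0.
  - have /size1_polyC Dp : (size (drop_poly k p) <= 1)%N.
      by rewrite size_drop_poly leq_subLR addn1.
    rewrite -{1}(poly_take_drop k p) hornerD hornerM hornerXn addrC Dp.
    by rewrite hornerC coef_drop_poly.
exists (a *: 'X^k + p).
  rewrite rpredD ?polyOverZ ?segP ?polyOverXn //=.
  rewrite (leq_trans (size_polyD _ _)) // geq_max (leqW pk) andbT.
  by rewrite (leq_trans (size_scale_leq _ _)) ?size_polyXn.
by rewrite hornerD hornerZ hornerXn.
Qed.

(** An option of [a * w ^+ k + t] changes [t] to a smaller [t'], or changes [a * w ^+ k] to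
    [b * w ^+ k + a * c + b * c] with [b < a] and [c < w ^+ k]. Since [S k] is the segment of
    [w ^+ k], it contains [t'] and [c]. *)
Let S_initial k x y : (forall z, S k z <-> (z < w ^+ k)%O) ->
  S k.+1 x -> (y < x)%O -> S k.+1 y.
Proof.
move=> Sk /S_leading[a [t [aw St ->]]].
case/on_add_lt=> [[_ /on_mul_lt[b [c [ba cw ->]]] ->]|].
  have bw := lt_trans ba aw; apply/S_leading; exists b, (a * c + b * c + t).
  split; rewrite ?addrA //; apply: S_add St.
  by apply: S_add; apply: S_mul => //; apply/Sk.
move=> [t' t't ->]; apply/S_leading; exists a, t'; split=> //; apply/Sk.
by apply: lt_trans t't _; apply/Sk.
Qed.

(* If the polynomials of degree less than [k], evaluated at [w], form the
   ordinal [w ^+ k], then those of degree at most [k] form an initial segment.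
   The options of [w ^+ k.+1] are among the [w ^+ k.+1 - q.[w]] with [q] monic
   of degree [k.+1] split over [seg w]; they lie in this segment but [w ^+ k.+1]
   does not, so they make up the whole segment: every monic polynomial of degree
   [k.+1] over [seg w] is split. *)
Lemma seg_split k : (k <= n)%N -> (forall z, S k z <-> (z < w ^+ k)%O) /\
  forall q : {poly On}, q \is monic -> q \is a polyOver (mem (seg w)) ->
    size q = k.+1 -> exists2 s : seq On,
      all (fun a => (a < w)%O) s & q = \prod_(a <- s) ('X - a%:P).
Proof.
elim: k => [_|k IH kn].
  split=> [z|q mq qw /eqP sq].
    rewrite expr0 on_lt1; split=> [[p /andP[_]]|/eqP->].
      by rewrite leqn0 size_poly_eq0 => /eqP-> ->; rewrite horner0.
    by exists 0; rewrite ?horner0 // rpred0 size_poly0.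
  exists [::]; rewrite // big_nil; move: mq.
  rewrite monicE lead_coefE (eqP sq) /=.
  by rewrite {2}(size1_polyC (eq_leq (eqP sq))) => /eqP->.
have [Sk _] := IH (ltnW kn).
(* As [k.+1 <= n], the hypothesis [Nroot] makes evaluation at [w] injective up to degree [k.+1]. *)
have inj (p q : {poly On}) : p \is a polyOver (subfield_pred wP) ->
    q \is a polyOver (subfield_pred wP) -> (size p <= k.+2)%N ->
    (size q <= k.+2)%N -> p.[w] = q.[w] -> p = q.
  move=> pw qw pk qk E; apply/eqP; rewrite -subr_eq0; apply: contraT => pq0.
  have: ~~ root (p - q) w.
    apply: Nroot => //; first exact: rpredB pw qw.
    rewrite (leq_trans (size_polyD _ _)) // size_polyN geq_max.
    by rewrite (leq_trans pk) // (leq_trans qk).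
  by rewrite rootE hornerD hornerN E subrr eqxx.
have splitP (s : seq On) : all (fun a => (a < w)%O) s -> size s = k.+1 ->
    let r := \prod_(a <- s) ('X - a%:P) in
    [/\ r \is a polyOver (subfield_pred wP), r \is monic & size r = k.+2].
  move=> sw sk; split; rewrite ?monic_prod_XsubC ?size_prod_XsubC ?sk //.
  rewrite big_seq rpred_prod // => a /(allP sw) aw.
  by rewrite polyOverXsubC segP.
have Xw : 'X^(k.+1) \is a polyOver (subfield_pred wP) by exact: polyOverXn.
have options z : (z < w ^+ k.+1)%O -> exists s : seq On,
    [/\ all (fun a => (a < w)%O) s, size s = k.+1 &
        z = ('X^(k.+1) - \prod_(a <- s) ('X - a%:P)).[w]].
  move=> /on_expn_lt[s [sw sk ->]]; exists s; split=> //.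
  rewrite hornerD hornerN hornerXn horner_prod on_oppE; congr (_ + _).
  by apply: eq_bigr => a _; rewrite hornerXsubC on_oppE.
have Sk1 z : S k.+1 z <-> (z < w ^+ k.+1)%O.
  split=> [Sz|/options[s [sw sk ->]]]; last first.
    have [rw mr sr] := splitP s sw sk.
    exists ('X^(k.+1) - \prod_(a <- s) ('X - a%:P)) => //.
    by rewrite rpredB //= size_monicB ?monicXn ?size_polyXn.
  have NS : ~ S k.+1 (w ^+ k.+1).
    move=> [p /andP[pw pk] Ep]; have Xp : 'X^(k.+1) = p.
      by apply: inj; rewrite ?size_polyXn ?hornerXn // leqW.
    by move: pk; rewrite -Xp size_polyXn ltnn.
  case: (ltgtP z (w ^+ k.+1)) => // [lt_z|E]; case: NS; last by rewrite -E.
  exact: S_initial lt_z.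
split=> // q mq qw sq.
(* The leading terms cancel, so this value is below [w ^+ k.+1] and is thus an option; injectivity
   then identifies [q] with a split product. *)
have /Sk1/options[s [sw sk E]] : S k.+1 ('X^(k.+1) - q).[w].
  exists ('X^(k.+1) - q) => //.
  by rewrite rpredB //= size_monicB ?monicXn ?size_polyXn.
exists s => //; have [rw mr sr] := splitP s sw sk.
apply: inj => //; rewrite ?sq ?sr //.
by move: E; rewrite !hornerD !hornerN => /addrI/oppr_inj.
Qed.

(** Divided by its leading coefficient, [p] splits by [seg_split]; its degree being positive, there
    is a first linear factor. *)
Lemma seg_n_closed : n_closed n (seg w).
Proof.
move=> p pw /andP[p1 pn].
have l0 : lead_coef p != 0 by rewrite lead_coef_eq0 -size_poly_gt0 ltnW.
have sp : size p = (size p).-1.+1 by rewrite prednK // ltnW.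
have [|_ split_p] := @seg_split (size p).-1; first by rewrite -ltnS -sp.
have [|||s sw] := split_p ((lead_coef p)^-1 *: p).
- by rewrite monicE lead_coefZ mulVf.
- rewrite -(subfield_polyOver wP) polyOverZ // rpredV.
  by rewrite -subfield_polyOver in pw; exact: (polyOverP pw).
- by rewrite size_scale ?invr_eq0.
case: s sw => [_|a s /andP[aw _]] E.
  by move: p1; rewrite -(size_scale p (invr_neq0 l0)) E big_nil size_poly1.
exists a => //; rewrite -(rootZ _ _ (invr_neq0 l0)) E big_cons.
by rewrite rootM root_XsubC eqxx.
Qed.

End SegSplit.

(** * Algebraic closure and n-closure in On_2 *)

Lemma poly_roots_finite (R : idomainType) (p : {poly R}) : p != 0 ->
  exists s : seq R, forall x, root p x -> x \in s.
Proof.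
have [k] := ubnP (size p); elim: k p => // k IH p ltk p0.
have [[a /factor_theorem[q Dp]]|Nr] := pselect (exists a, root p a); last first.
  by exists [::] => x px; case: Nr; exists x.
have q0 : q != 0 by apply: contraNneq p0 => q0; rewrite Dp q0 mul0r.
have [|s qs] := IH q _ q0.
  move: ltk; rewrite Dp size_Mmonic ?monicXsubC // size_XsubC addn2.
  by rewrite ltnS.
exists (a :: s) => x; rewrite Dp rootM root_XsubC inE orbC.
by case/orP=> [->//|/qs->]; rewrite orbT.
Qed.

(** A smallness argument: an algebraic element is determined by a list of coefficients in [seg u]
    and a position in a finite list of roots. The bound provides an ordinal outside the closure,
    hence a least one. *)
Lemma on_algebraic_bounded (u : On) :
  exists m, forall x, on_algebraic_closure u x -> (x < m)%O.
Proof.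
have [A [f fP]] := seg_small u.
have [p|roots rootsP] := @choice {poly On} (seq On)
  (fun p s => p != 0 -> forall x, root p x -> x \in s).
  have [p0|/poly_roots_finite[s sP]] := eqVneq p 0; last by exists s.
  by exists [::].
have [m mP] := on_bounded
  (fun c : seq A * nat => nth 0 (roots (Poly (map f c.1))) c.2).
exists m => x [p [/allP pu p0 px]].
have [c Dc] : exists c, map f c = p.
  elim: (polyseq p) pu => [|y s IHs] pu; first by exists [::].
  have [a <-] : exists a, f a = y.
    by apply: fP; apply/set_mem; apply: pu; rewrite inE eqxx.
  have [|c <-] := IHs; last by exists (a :: c).
  by move=> z zs; apply: pu; rewrite inE zs orbT.
have xp := rootsP p p0 x px.
by have := mP (c, index x (roots p)); rewrite /= Dc polyseqK nth_index.
Qed.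

Lemma set_min_notin (C : set On) m : ~ C m ->
  exists2 w, ~ C w & seg w `<=` C.
Proof.
elim/on_ind: m => m IH Nm.
have [[k [km Nk]]|Cm] := pselect (exists k, (k < m)%O /\ ~ C k).
  exact: IH Nk.
by exists m => // k km; apply: contrapT => Nk; apply: Cm; exists k.
Qed.

Lemma polyOver_subset (R : nzRingType) (A B : set R) (p : {poly R}) :
  A `<=` B -> p \is a polyOver (mem A) -> p \is a polyOver (mem B).
Proof. by move=> AB; apply: polyOverS => x /set_mem/AB/mem_set. Qed.

Lemma seg_subset (u w : On) (C : set On) :
  seg u `<=` C -> ~ C w -> seg u `<=` seg w.
Proof.
move=> uC Nw x xu; apply: lt_le_trans xu _.
by rewrite leNgt; apply: contra_notN Nw => /uC.
Qed.

Lemma n_closure_subfield (L : fieldType) (n : nat) (K Kbar : set L) :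
  subfield (n_closure_in n K Kbar).
Proof.
set C := n_closure_in n K Kbar.
have CF F x : [/\ subfield F, n_closed n F, K `<=` F & F `<=` Kbar] ->
    x \in mem C -> x \in mem F.
  by move=> FP /set_mem Cx; apply: mem_set; exact: Cx.
split=> [|x y Cx Cy|x y Cx Cy]; apply: mem_set => F FP; apply: set_mem.
- by case: FP => -[].
- by case: (FP) => -[_ FB _] _ _ _; apply: FB; exact: CF FP _.
- by case: (FP) => -[_ _ FV] _ _ _; apply: FV; exact: CF FP _.
Qed.

Lemma on_algebraic_closureP (u : On) : field_ordinal u ->
  is_algebraic_closure (seg u) (on_algebraic_closure u).
Proof.
move=> uP; have AP := algebraic_over_subfield uP.
split=> //; first exact: (sub_algebraic_over uP).
have [m mP] := on_algebraic_bounded u.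
have [|w Nw wA] := @set_min_notin (on_algebraic_closure u) m.
  by move/mP; rewrite ltxx.
have wP := seg_subfield AP wA Nw.
have uw := seg_subset (sub_algebraic_over uP) Nw.
have wcl n : n_closed n (seg w).
  apply: seg_n_closed => // p /(polyOver_subset wA) pA p0 _.
  by apply/negP => /(algebraic_over_trans uP pA p0).
have Aw : on_algebraic_closure u `<=` seg w.
  move=> x [p [pu p0 px]].
  apply: (n_closed_root wP (wcl (size p)) _ _ p0 px) => //.
  exact: polyOver_subset pu.
move=> p /(polyOver_subset Aw) pw p1.
have [|x /wA Ax px] := wcl (size p) p pw; first by rewrite p1 /=.
by exists x.
Qed.

Theorem proposition3p2 (u : On) (n : nat) :
  field_ordinal u -> (1 <= n)%N ->
  is_n_closure n (seg u) (on_n_closure n u) /\ is_ordinal (on_n_closure n u).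
Proof.
move=> uP _; have AP := on_algebraic_closureP uP.
split; first by exists (on_algebraic_closure u).
have [Asub uA _ Acl] := AP.
set C := on_n_closure n u.
(* The algebraic closure is itself one of the intersected fields. *)
have CA : C `<=` on_algebraic_closure u.
  by move=> x; apply; split=> // p pA /andP[p1 _]; exact: Acl.
have uC : seg u `<=` C by move=> x xu F [_ _ uF _]; exact: uF.
have CP : subfield C by exact: n_closure_subfield.
have [m mP] := on_algebraic_bounded u.
have [|w Nw wC] := @set_min_notin C m; first by move/CA/mP; rewrite ltxx.
have wP := seg_subfield CP wC Nw.
(* For the inclusion of [C] in [seg w], membership in [C] is applied to the field [seg w], which
   must be shown to be one of those intersected. *)
exists w; apply/seteqP; split=> // x; apply; split=> //; first last.
- by move=> y /wC/CA.
- exact: seg_subset Nw.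
apply: seg_n_closed => // p pw p0 pn; apply/negP => pw0; apply: Nw.
move=> F [FP nF uF FA]; apply: (n_closed_root FP nF _ pn p0 pw0).
apply: polyOver_subset pw => y /wC; apply.
by split.
Qed.
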